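(* For each positive integer $d$, let $C_H(d)$ be the sharp constant in the discrete Hardy inequality $$\sum_{n \in \mathbb{Z}^d} |Du(n)|^2 \geq C_H(d) \sum_{n \in \mathbb{Z}^d} \frac{|u(n)|^2}{|n|^{2}},\qquad u \in C_c(\mathbb{Z}^d),\ u(0)=0,$$ i.e. the largest constant for which this inequality holds for all $u\in C_c(\mathbb{Z}^d)$ with $u(0)=0$. Then $C_H(d) \sim d$ as $d \to \infty$; that is, there exist positive constants $c_1, c_2$ and $N$, independent of $d$, such that $c_1 d\leq C_H(d) \leq c_2 d$ for all $d\geq N$.
   Context: $C_c(\mathbb{Z}^d)$ denotes the space of finitely supported (complex-valued) functions on $\mathbb{Z}^d$; $|n|$ is the Euclidean norm of $n \in \mathbb{Z}^d$; $e_j$ is the $j$-th canonical basis vector of $\mathbb{R}^d$. For $u:\mathbb{Z}^d\to\mathbb{C}$, $D_j u(n) := u(n)-u(n-e_j)$, $Du(n) := (D_1u(n),\dots,D_du(n))$, and $|Du(n)|^2=\sum_{j=1}^d |D_ju(n)|^2$. Since $u(0)=0$, the term $n=0$ in the sum weighted by $|n|^{-2}$ is understood to be $0$. *)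

(* Defs.v *)
From mathcomp Require Import all_boot all_order all_algebra.
From mathcomp Require Import boolp classical_sets functions cardinality fsbigop.
From mathcomp Require Import reals.
From mathcomp Require Import complex.

Set Implicit Arguments.
Unset Strict Implicit.
Unset Printing Implicit Defensive.

Import Order.TTheory GRing.Theory Num.Theory.
Import ComplexField.

Local Open Scope classical_set_scope.
Local Open Scope ring_scope.

Section Hardy.
Variable R : realType.

(* The R-valued modulus; `|z| would live in R[i]. *)
Definition cabs (z : R[i]) : R := Normc.normc z.

Section Lattice.
Variable d : nat.

Definition euclid_norm (n : 'rV[int]_d) : R :=
  Num.sqrt (\sum_(j < d) (n 0 j)%:~R ^+ 2).

Definition bdiff (j : 'I_d) (u : 'rV[int]_d -> R[i]) (n : 'rV[int]_d) : R[i] :=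
  u n - u (n - delta_mx 0 j).

Definition grad_sq (u : 'rV[int]_d -> R[i]) (n : 'rV[int]_d) : R :=
  \sum_(j < d) cabs (bdiff j u n) ^+ 2.

(* Division by zero yields 0, so that the value at n = 0 is 0. *)
Definition hardy_term (u : 'rV[int]_d -> R[i]) (n : 'rV[int]_d) : R :=
  cabs (u n) ^+ 2 / euclid_norm n ^+ 2.

Definition finitely_supported (u : 'rV[int]_d -> R[i]) : Prop :=
  finite_set [set n | u n != 0].

(* \sum_(n \in A) is 0 by default when the summand has infinite support in A;
   finite_support_grad_sq and finite_support_hardy_term below show that this
   never happens here. *)
Definition hardy_ineq (C : R) : Prop :=
  forall u : 'rV[int]_d -> R[i], finitely_supported u -> u 0 = 0 ->
    \sum_(n \in [set: 'rV[int]_d]) grad_sq u n >=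
      C * \sum_(n \in [set: 'rV[int]_d]) hardy_term u n.

(* hardy_const_max below shows that for 0 < d this supremum is a maximum. *)
Definition hardy_const : R := sup [set C | hardy_ineq C].

Lemma cabs0 : cabs 0 = 0. Proof. exact: Normc.normc0. Qed.

Lemma finite_support_grad_sq u : finitely_supported u ->
  finite_set [set n | grad_sq u n != 0].
Proof.
move=> fu.
pose S := [set n | u n != 0].
have fS : finite_set (S `|` \bigcup_(j in [set: 'I_d])
    [set m + delta_mx 0 j | m in S]).
  rewrite finite_setU; split => //.
  apply: bigcup_finite => [|j _]; first exact: finite_finset.
  exact: finite_image.
apply: sub_finite_set fS => n /= gn.
have [un|un] := eqVneq (u n) 0; last by left.
right; apply: contrapT => nS; move/eqP: gn; apply.
rewrite /grad_sq big1 // => j _; rewrite /bdiff un.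
have [->|uj] := eqVneq (u (n - delta_mx 0 j)) 0.
  by rewrite subr0 cabs0 expr0n.
by case: nS; exists j => //; exists (n - delta_mx 0 j); rewrite ?subrK.
Qed.

Lemma finite_support_hardy_term u : finitely_supported u ->
  finite_set [set n | hardy_term u n != 0].
Proof.
apply: sub_finite_set => n /=; apply: contra_neq => un.
by rewrite /hardy_term un cabs0 expr0n mul0r.
Qed.

End Lattice.

Lemma hardy_const_max d : (0 < d)%N ->
  hardy_ineq d (hardy_const d) /\
  (forall C, hardy_ineq d C -> C <= hardy_const d).
Proof.
move=> d_gt0.
have term_ge0 (u : 'rV[int]_d -> R[i]) n : 0 <= hardy_term u n.
  by rewrite divr_ge0 ?sqr_ge0.
have hsum_ge0 (u : 'rV[int]_d -> R[i]) :
    0 <= \sum_(n \in [set: 'rV[int]_d]) hardy_term u n.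
  by apply: fsumr_ge0 => n _; exact: term_ge0.
have gsum_ge0 (u : 'rV[int]_d -> R[i]) :
    0 <= \sum_(n \in [set: 'rV[int]_d]) grad_sq u n.
  by apply: fsumr_ge0 => n _; apply: sumr_ge0 => j _; rewrite sqr_ge0.
pose e : 'rV[int]_d := delta_mx 0 (Ordinal d_gt0).
pose v (n : 'rV[int]_d) : R[i] := (n == e)%:R.
have e_neq0 : e != 0.
  apply/eqP => /matrixP/(_ 0 (Ordinal d_gt0)).
  by rewrite !mxE !eqxx.
have v_fin : finitely_supported v.
  apply: (@sub_finite_set _ _ [set e]); last exact: finite_set1.
  by move=> n /=; rewrite /v; case: (eqVneq n e); rewrite ?eqxx.
have v0 : v 0 = 0 by rewrite /v eq_sym (negbTE e_neq0).
have ve : \sum_(n \in [set: 'rV[int]_d]) hardy_term v n = 1.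
  rewrite -(@fsbig_widen _ _ _ _ [set e]) //; last first.
    move=> n /= [_ /eqP ne].
    by rewrite /hardy_term /v (negbTE ne) cabs0 expr0n mul0r.
  rewrite fsbig_set1 /hardy_term /v eqxx.
  rewrite [cabs _]Normc.normc1 /euclid_norm (bigD1 (Ordinal d_gt0)) //= big1.
    by rewrite mxE !eqxx addr0 expr1n sqrtr1 expr1n divr1.
  by move=> j /negbTE jn; rewrite mxE jn /= expr0n.
have hubd : has_ubound [set C | hardy_ineq d C].
  exists (\sum_(n \in [set: 'rV[int]_d]) grad_sq v n) => C /= hC.
  by have := hC v v_fin v0; rewrite ve mulr1.
have hne : [set C | hardy_ineq d C] !=set0.
  by exists 0 => u _ _; rewrite mul0r.
split=> [u fu u0|C hC]; last exact: ub_le_sup.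
have := hsum_ge0 u; rewrite le_eqVlt => /orP[/eqP <-|s_gt0].
  by rewrite mulr0.
rewrite -ler_pdivlMr //; apply: ge_sup => // C hC.
by rewrite ler_pdivlMr //; exact: hC.
Qed.

End Hardy.

(* Main.v *)
Require Import Defs.
From mathcomp Require Import all_boot all_order all_algebra.
From mathcomp Require Import reals.
From mathcomp Require Import finmap boolp classical_sets cardinality fsbigop.
From mathcomp Require Import complex ring lra zify.

(** The upper bound comes from testing the inequality on the indicator of a
    basis vector: its Hardy sum is 1, while the energy of any [u] is at most
    4 d times its squared l2 norm ([energy_le]).

    The lower bound is a ground state argument.  If [w] is positive on the
    support of [u], then on every edge {n, m} the arithmetic-geometric mean
    inequality gives
      |u n - u m|^2 >= |u n|^2 (1 - w m / w n) + |u m|^2 (1 - w n / w m),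
    and summing over edges bounds the energy below by the sum of
    |u n|^2 (- Delta w n) / w n ([ground_state_inequality]).  It remains to find
    [w] with - Delta w / w >= c d / |n|^2 away from the origin.

    The power |n|^(-(d-2)/2) of the continuous theory would aim at a constant of
    order d^2, which is out of reach near the origin, where |n|^2 is much
    smaller than d.  The fixed power w n = 1 / |n|^2 suffices.  With s = |n|^2,
    the neighbours n +- e_j have squared norm s + 1 +- 2 n_j.  The unit shift
    from s to s + 1 makes w decrease on average and contributes
    2 / (s + 1) in each of the d directions; the convexity of 1 / s works
    against this, but costs only O(n_j^2 / s^2) in direction j
    ([second_difference_inv]).  As the n_j^2 add up to s, the total loss is
    O(1 / s) independently of d, hence negligible against 2 d / (s + 1) once d
    is large ([inv_sqr_supersolution]).  Finally, w 0 = 0 since 1 / 0 = 0: this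
    agrees with u 0 = 0, and a zero value of [w] at a neighbour only helps. *)

Import Order.TTheory GRing.Theory Num.Theory.

Local Open Scope classical_set_scope.
Local Open Scope ring_scope.

(** * Sums of finitely supported functions *)

Lemma ler_fsum_supp {R : realType} {I : choiceType} (f g : I -> R) :
  finite_set [set i | f i != 0] -> finite_set [set i | g i != 0] ->
  (forall i, f i <= g i) ->
  \sum_(i \in [set: I]) f i <= \sum_(i \in [set: I]) g i.
Proof.
move=> ffin gfin fg; pose A := fset_set ([set i | f i != 0] `|` [set i | g i != 0]).
have Ain i : i \notin A -> f i = 0 /\ g i = 0.
  rewrite in_fset_set ?finite_setU// notin_setE /= => /not_orP[].
  by move=> /negP; rewrite negbK => /eqP -> /negP; rewrite negbK => /eqP ->.
rewrite !(fsbigTE A); try by move=> i /Ain[].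
exact: ler_sum.
Qed.

Lemma bijective_subr {V : zmodType} (a : V) : bijective (fun x => x - a).
Proof. by exists (+%R^~ a) => x; rewrite ?subrK ?addrK. Qed.

(** Passes from a sum over edges to a sum over vertices: on the edge
    {n, n - e_j}, [p] is charged to one end and [q] to the other, and
    translating by e_j collects the [q] charges at their own vertex. *)
Lemma fsum_edges_vertices {R : realType} {d : nat}
    (p q : 'I_d -> 'rV[int]_d -> R) (S : set 'rV[int]_d) :
  finite_set S ->
  (forall j n, ~ S n -> p j n = 0) -> (forall j n, ~ S n -> q j n = 0) ->
  finite_set [set n | \sum_(j < d) (p j n + q j (n - delta_mx 0 j)) != 0] /\
  \sum_(n \in [set: 'rV[int]_d]) \sum_(j < d) (p j n + q j (n - delta_mx 0 j))
  = \sum_(n \in [set: 'rV[int]_d]) \sum_(j < d) (p j n + q j n).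
Proof.
move=> Sfin p0 q0.
pose T := S `|` \bigcup_(j in [set: 'I_d]) [set m + delta_mx 0 j | m in S].
have Tfin : finite_set T.
  rewrite finite_setU; split => //.
  apply: bigcup_finite => [|j _]; first exact: finite_finset.
  exact: finite_image.
have pT j n : ~ T n -> p j n = 0 by move=> nT; apply: p0 => Sn; apply: nT; left.
have qT j n : ~ T n -> q j n = 0 by move=> nT; apply: q0 => Sn; apply: nT; left.
have qsT j n : ~ T n -> q j (n - delta_mx 0 j) = 0.
  move=> nT; apply: q0 => Sn; apply: nT; right; exists j => //.
  by exists (n - delta_mx 0 j); rewrite ?subrK.
split.
  apply: sub_finite_set Tfin => n /=; apply: contraPP => nT.
  by apply/negP; rewrite negbK big1// => j _; rewrite pT// qsT// addr0.
have AT n : n \notin fset_set T -> ~ T n.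
  by rewrite in_fset_set// notin_setE.
rewrite !(fsbigTE (fset_set T)); first last.
- by move=> n /AT nT; rewrite big1// => j _; rewrite pT// qsT// addr0.
- by move=> n /AT nT; rewrite big1// => j _; rewrite pT// qT// addr0.
under eq_bigr do rewrite big_split.
under [RHS]eq_bigr do rewrite big_split.
rewrite !big_split; congr (_ + _).
rewrite exchange_big [RHS]exchange_big; apply: eq_bigr => j _ /=.
rewrite -(fsbigTE (fset_set T) (fun n => q j (n - delta_mx 0 j))); last first.
  by move=> n /AT; exact: qsT.
rewrite -(fsbigTE (fset_set T) (q j)); last by move=> n /AT; exact: qT.
rewrite [RHS](reindex_fsbigT (fun n => n - delta_mx 0 j)) //.
exact: bijective_subr.
Qed.

(** * The ground state inequality *)

Section Cabs.
Context {R : realType}.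
Implicit Types a b : R[i].

Lemma cabs_ge0 a : 0 <= cabs a.
Proof. by case: a => x y; exact: sqrtr_ge0. Qed.

Lemma cabsB_le a b : cabs (a - b) <= cabs a + cabs b.
Proof. by rewrite -[cabs b]normcN; exact: le_normcD. Qed.

End Cabs.

(** With x = |z| and y = |t|, the difference (x - y)^2 - LHS is the square
    (x b - y a)^2 / (a b).  A weight may vanish only where the value does, and
    there the quotient by that weight is multiplied by 0. *)
Lemma edge_ground_state {R : realType} (z t : R[i]) (a b : R) :
  0 <= a -> 0 <= b -> (z != 0 -> 0 < a) -> (t != 0 -> 0 < b) ->
  cabs z ^+ 2 * (1 - b / a) + cabs t ^+ 2 * (1 - a / b) <= cabs (z - t) ^+ 2.
Proof.
move=> a0 b0 za tb.
have [->|z0] := eqVneq z 0.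
  rewrite sub0r [cabs (- t)]normcN cabs0 expr0n mul0r add0r.
  by rewrite ler_piMr ?sqr_ge0// gerBl divr_ge0.
have [->|t0] := eqVneq t 0.
  rewrite subr0 cabs0 expr0n mul0r addr0.
  by rewrite ler_piMr ?sqr_ge0// gerBl divr_ge0.
have {za z0}a_gt0 := za z0; have {tb t0}b_gt0 := tb t0.
have le1 : cabs z <= cabs (z - t) + cabs t.
  by rewrite -{1}(subrK t z); exact: le_normcD.
have le2 : cabs t <= cabs (z - t) + cabs z.
  rewrite -[cabs (z - t)]normcN opprB -{1}(subrK z t); exact: le_normcD.
have := cabs_ge0 (z - t).
move: (cabs z) (cabs t) (cabs (z - t)) le1 le2 => x y r le1 le2 r0.
apply: (@le_trans _ _ ((x - y) ^+ 2)); last by nra.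
rewrite -subr_ge0.
have -> : (x - y) ^+ 2 - (x ^+ 2 * (1 - b / a) + y ^+ 2 * (1 - a / b)) =
    (x * b - y * a) ^+ 2 / (a * b) by field; rewrite !gt_eqF.
by rewrite divr_ge0 ?sqr_ge0 ?mulr_ge0.
Qed.

(** The values of [w] off the support of [u] only need to be nonnegative, which
    allows [w] to vanish at the origin. *)
Lemma ground_state_inequality {R : realType} {d : nat}
    (w : 'rV[int]_d -> R) (u : 'rV[int]_d -> R[i]) (V : 'rV[int]_d -> R) :
  finitely_supported u ->
  (forall n, 0 <= w n) -> (forall n, u n != 0 -> 0 < w n) ->
  (forall n, u n != 0 ->
    V n <= \sum_(j < d) (2 - w (n - delta_mx 0 j) / w n
                           - w (n + delta_mx 0 j) / w n)) ->
  \sum_(n \in [set: 'rV[int]_d]) cabs (u n) ^+ 2 * V n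
  <= \sum_(n \in [set: 'rV[int]_d]) grad_sq u n.
Proof.
move=> ufin w0 wu Vle.
pose p j n := cabs (u n) ^+ 2 * (1 - w (n - delta_mx 0 j) / w n).
pose q j n := cabs (u n) ^+ 2 * (1 - w (n + delta_mx 0 j) / w n).
have supp0 n c : ~ [set n | u n != 0] n -> cabs (u n) ^+ 2 * c = 0.
  by move=> /= /negP; rewrite negbK => /eqP ->; rewrite cabs0 expr0n mul0r.
have suppfin F : finite_set [set n | cabs (u n) ^+ 2 * F n != 0].
  apply: sub_finite_set ufin => n /=; apply: contraNN => /eqP ->.
  by rewrite cabs0 expr0n mul0r.
have [fin eqs] := fsum_edges_vertices p q _ ufin
  (fun j n => supp0 n _) (fun j n => supp0 n _).
apply: (@le_trans _ _ (\sum_(n \in [set: 'rV[int]_d]) \sum_(j < d) (p j n + q j n))).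
  have pqE n : \sum_(j < d) (p j n + q j n) = cabs (u n) ^+ 2 *
      \sum_(j < d) (2 - w (n - delta_mx 0 j) / w n - w (n + delta_mx 0 j) / w n).
    by rewrite mulr_sumr; apply: eq_bigr => j _; rewrite /p /q; ring.
  under [leRHS]eq_fsbigr do rewrite pqE.
  apply: ler_fsum_supp => // n.
  have [->|un] := eqVneq (u n) 0; first by rewrite cabs0 expr0n !mul0r.
  by rewrite ler_wpM2l ?sqr_ge0// Vle.
rewrite -eqs; apply: ler_fsum_supp => //; first exact: finite_support_grad_sq.
move=> n; apply: ler_sum => j _; rewrite /p /q /bdiff subrK.
by apply: edge_ground_state => //; exact: wu.
Qed.

(** |a - b|^2 <= 2 |a|^2 + 2 |b|^2 on each edge, and every vertex lies on 2 d
    edges. *)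
Lemma energy_le {R : realType} {d : nat} (u : 'rV[int]_d -> R[i]) :
  finitely_supported u ->
  \sum_(n \in [set: 'rV[int]_d]) grad_sq u n
  <= 4 * d%:R * \sum_(n \in [set: 'rV[int]_d]) cabs (u n) ^+ 2.
Proof.
move=> ufin.
pose p (j : 'I_d) n := 2 * cabs (u n) ^+ 2.
have p0 j n : ~ [set n | u n != 0] n -> p j n = 0.
  by move=> /= /negP; rewrite negbK /p => /eqP ->; rewrite cabs0 expr0n mulr0.
have [fin eqs] := fsum_edges_vertices p p _ ufin p0 p0.
have ppE n : 4 * d%:R * cabs (u n) ^+ 2 = \sum_(j < d) (p j n + p j n).
  by rewrite /p sumr_const card_ord -mulr_natr; ring.
rewrite mulr_fsumr; under [leRHS]eq_fsbigr do rewrite ppE.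
rewrite -eqs; apply: ler_fsum_supp => //; first exact: finite_support_grad_sq.
move=> n; apply: ler_sum => j _; rewrite /p /bdiff.
have := cabsB_le (u n) (u (n - delta_mx 0 j)).
have := cabs_ge0 (u n - u (n - delta_mx 0 j)).
move: (cabs (u n - _)) (cabs (u n)) (cabs (u (n - _))) => x y z x0 xyz.
by have := sqr_ge0 (y - z); nra.
Qed.

(** * The weight |n|^-2 *)

Section Weight.
Context {R : realType} {d : nat}.
Implicit Types n : 'rV[int]_d.

Lemma euclid_norm_sqr n :
  euclid_norm R n ^+ 2 = (\sum_(j < d) n 0 j ^+ 2)%:~R.
Proof.
rewrite sqr_sqrtr; last by apply: sumr_ge0 => j _; rewrite sqr_ge0.
by rewrite rmorph_sum; apply: eq_bigr => j _; rewrite rmorphXn.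
Qed.

Lemma euclid_norm_sqrD n (e : int) j :
  euclid_norm R (n + e *: delta_mx 0 j) ^+ 2 =
  euclid_norm R n ^+ 2 + (2 * e * n 0 j + e ^+ 2)%:~R.
Proof.
rewrite !euclid_norm_sqr -rmorphD; congr (_%:~R).
rewrite (bigD1 j)//= [in RHS](bigD1 j)//= !mxE !eqxx mulr1.
under eq_bigr => k /negPf kj do rewrite !mxE kj mulr0 addr0.
ring.
Qed.

Lemma sqr_coord_le n j : n 0 j ^+ 2 <= \sum_(k < d) n 0 k ^+ 2.
Proof.
by rewrite (bigD1 j)//= lerDl; apply: sumr_ge0 => k _; rewrite sqr_ge0.
Qed.

Lemma sum_sqr_gt0 n : n != 0 -> 0 < \sum_(k < d) n 0 k ^+ 2.
Proof.
move=> n0; rewrite lt_def sumr_ge0 ?andbT; last by move=> k _; rewrite sqr_ge0.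
apply: contraNneq n0 => /eqP; rewrite psumr_eq0; last by move=> k _; rewrite sqr_ge0.
move=> /allP/= s0; apply/eqP/rowP => j; rewrite mxE.
by have := s0 j (mem_index_enum _); rewrite sqrf_eq0 => /eqP.
Qed.

End Weight.

(** Here [s] stands for |n|^2 and [a] for a coordinate of n.  With
    D = (s + 1)^2 - 4 a^2, the right-hand side is exactly
    2 / (s + 1) - 8 a^2 s / ((s + 1) D), and a^2 <= s gives D >= (s - 1)^2, so
    s^2 <= 4 D as soon as s >= 2; this is where 32 = 8 * 4 comes from.  When
    s = 1 and a = +-1 one neighbour is the origin, where the quotient is 0. *)
Lemma second_difference_inv {R : realType} (s a : int) :
  0 < s -> a ^+ 2 <= s ->
  2 / (s%:~R + 1) - 32 * a%:~R ^+ 2 / (s%:~R * (s%:~R + 1)) <=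
  2 - s%:~R / (s%:~R + 1 - 2 * a%:~R) - s%:~R / (s%:~R + 1 + 2 * a%:~R) :> R.
Proof.
move=> s_gt0 a_le.
have [s_ge2|s_lt2] := leP 2 s; last first.
  have s1 : s = 1 by lia.
  rewrite {}s1 in a_le *.
  have a_int : -1 <= a <= 1 by nia.
  have : [|| a == 0, a == 1 | a == -1] by lia.
  have -> : 1%:~R + 1 = 2 :> R by [].
  case/or3P => /eqP ->.
  - by rewrite rmorph0 expr0n /= !mulr0 mul0r !subr0 addr0; lra.
  - have -> : 2 - 2 * 1%:~R = 0 :> R by ring.
    have -> : 2 + 2 * 1%:~R = 4 :> R by ring.
    by rewrite invr0; lra.
  - have -> : 2 - 2 * (-1)%:~R = 4 :> R by ring.
    have -> : 2 + 2 * (-1)%:~R = 0 :> R by ring.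
    by rewrite invr0; lra.
have {a_le}xA : a%:~R ^+ 2 <= s%:~R :> R by rewrite -rmorphXn ler_int.
have {s_gt0 s_ge2}s2 : 2 <= s%:~R :> R by rewrite (ler_int _ 2).
move: (s%:~R) (a%:~R) xA s2 => {}s {}a as_ s2.
have D1 : (s - 1) ^+ 2 <= (s + 1 - 2 * a) * (s + 1 + 2 * a) by nra.
have D2 : s ^+ 2 <= 4 * ((s + 1 - 2 * a) * (s + 1 + 2 * a)) by nra.
have D_gt0 : 0 < (s + 1 - 2 * a) * (s + 1 + 2 * a) by nra.
have /andP[m0 p0] : (s + 1 - 2 * a != 0) && (s + 1 + 2 * a != 0).
  by rewrite -negb_or -mulf_eq0 gt_eqF.
have -> : 2 - s / (s + 1 - 2 * a) - s / (s + 1 + 2 * a) =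
    2 / (s + 1) - 8 * a ^+ 2 * s / ((s + 1) * ((s + 1 - 2 * a) * (s + 1 + 2 * a))).
  by field; rewrite m0 p0 gt_eqF//; lra.
rewrite lerD2l lerN2 ler_pdivrMr; last by rewrite mulr_gt0//; lra.
have -> : 32 * a ^+ 2 / (s * (s + 1)) *
    ((s + 1) * ((s + 1 - 2 * a) * (s + 1 + 2 * a))) =
    8 * a ^+ 2 * (4 * ((s + 1 - 2 * a) * (s + 1 + 2 * a))) / s.
  by field; rewrite !gt_eqF//; lra.
rewrite ler_pdivlMr; last by lra.
rewrite [leLHS](_ : _ = 8 * a ^+ 2 * s ^+ 2); last by ring.
by rewrite ler_wpM2l// mulr_ge0 ?sqr_ge0.
Qed.

(** * The two bounds *)

(** Summing [second_difference_inv] over the coordinates leaves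
    (2 d - 32) / (s + 1) with s = |n|^2 >= 1, which is at least
    (d - 16) / s, hence at least (d / 2) / s when d >= 32. *)
Lemma inv_sqr_supersolution {R : realType} {d : nat} (n : 'rV[int]_d) :
  (32 <= d)%N -> n != 0 ->
  d%:R / 2 / euclid_norm R n ^+ 2 <=
  \sum_(j < d)
    (2 - (euclid_norm R (n - delta_mx 0 j) ^+ 2)^-1 / (euclid_norm R n ^+ 2)^-1
       - (euclid_norm R (n + delta_mx 0 j) ^+ 2)^-1 / (euclid_norm R n ^+ 2)^-1).
Proof.
move=> d32 n0; have sumE := euclid_norm_sqr (R := R) n.
have s_gt0 := sum_sqr_gt0 n n0; have le_s := sqr_coord_le n.
move: (\sum_(j < d) n 0 j ^+ 2) sumE s_gt0 le_s => s sumE s_gt0 le_s.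
have s1 : 1 <= s%:~R :> R by rewrite (ler_int _ 1).
apply: (@le_trans _ _ (\sum_(j < d)
    (2 / (s%:~R + 1) - 32 * (n 0 j)%:~R ^+ 2 / (s%:~R * (s%:~R + 1))))).
  rewrite sumrB sumr_const card_ord -mulr_suml -mulr_sumr.
  have -> : \sum_(j < d) (n 0 j)%:~R ^+ 2 = s%:~R :> R.
    by rewrite -sumE euclid_norm_sqr rmorph_sum; apply: eq_bigr => j _; rewrite rmorphXn.
  have d32R : 32 <= d%:R :> R by rewrite (ler_nat _ 32).
  rewrite sumE -[2 / _ *+ d]mulr_natr -subr_ge0.
  move: (s%:~R : R) (d%:R : R) s1 d32R => {sumE}x y x1 y32.
  have -> : 2 / (x + 1) * y - 32 * x / (x * (x + 1)) - y / 2 / x =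
     (3 * x * y - 64 * x - y) / (2 * x * (x + 1)).
    by field; rewrite !gt_eqF//; lra.
  by rewrite divr_ge0//; nra.
apply: ler_sum => j _.
have <- : n + (-1) *: delta_mx 0 j = n - delta_mx 0 j by rewrite scaleN1r.
have <- : n + 1 *: delta_mx 0 j = n + delta_mx 0 j by rewrite scale1r.
rewrite !euclid_norm_sqrD sumE invrK.
apply: le_trans (second_difference_inv s (n 0 j) s_gt0 (le_s j)) _.
rewrite [X in 2 - X - _]mulrC [X in _ - X]mulrC.
have -> : s%:~R + (2 * -1 * n 0 j + (-1) ^+ 2)%:~R =
    s%:~R + 1 - 2 * (n 0 j)%:~R :> R.
  by rewrite rmorphD/= !rmorphM/= !rmorphN1; ring.
have -> : s%:~R + (2 * 1 * n 0 j + 1 ^+ 2)%:~R =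
    s%:~R + 1 + 2 * (n 0 j)%:~R :> R.
  by rewrite rmorphD/= !rmorphM/= !rmorph1; ring.
by [].
Qed.

Lemma hardy_ineq_half_dim {R : realType} {d : nat} :
  (32 <= d)%N -> hardy_ineq d (d%:R / 2 : R).
Proof.
move=> d32 u ufin u0.
have n0 n : u n != 0 -> n != 0 by apply: contra_neq => ->.
pose w (n : 'rV[int]_d) := (euclid_norm R n ^+ 2)^-1 : R.
pose V (n : 'rV[int]_d) := d%:R / 2 / euclid_norm R n ^+ 2 : R.
have termE n : d%:R / 2 * hardy_term u n = cabs (u n) ^+ 2 * V n.
  by rewrite mulrCA mulrA.
rewrite mulr_fsumr; under eq_fsbigr do rewrite termE.
apply: (ground_state_inequality w u V) => //.
- by move=> n; rewrite invr_ge0 sqr_ge0.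
- move=> n /n0 nn0.
  by rewrite /w invr_gt0 euclid_norm_sqr ltr0z sum_sqr_gt0.
- by move=> n /n0; exact: inv_sqr_supersolution.
Qed.

Lemma hardy_const_le {R : realType} {d : nat} :
  (0 < d)%N -> hardy_const R d <= 4 * d%:R.
Proof.
move=> d_gt0; have [hardy _] := hardy_const_max R d_gt0.
pose e : 'rV[int]_d := delta_mx 0 (Ordinal d_gt0).
have norm_e : euclid_norm R e ^+ 2 = 1.
  rewrite -[e]add0r -[e]scale1r euclid_norm_sqrD euclid_norm_sqr.
  by rewrite big1 ?mxE ?mulr0 ?add0r ?expr1n// => j _; rewrite mxE expr0n.
have e_neq0 : e != 0.
  apply/eqP => e0; have /eqP := norm_e; rewrite e0 euclid_norm_sqr big1.
    by rewrite eq_sym oner_eq0.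
  by move=> j _; rewrite mxE expr0n.
pose v (n : 'rV[int]_d) : R[i] := (n == e)%:R.
have cabs_v n : n != e -> cabs (v n) = 0.
  by rewrite /v => /negPf ->; exact: cabs0.
have v_fin : finitely_supported v.
  apply: sub_finite_set (finite_set1 e) => n /=.
  by apply: contraNP => /eqP ne; rewrite /v (negPf ne).
have sum_at_e (F : 'rV[int]_d -> R) : (forall n, n != e -> F n = 0) ->
    \sum_(n \in [set: 'rV[int]_d]) F n = F e.
  move=> F0; rewrite -(@fsbig_widen _ _ _ _ [set e])// ?fsbig_set1//.
  by move=> n /= [_ /eqP]; exact: F0.
have v0 : v 0 = 0 by rewrite /v eq_sym (negPf e_neq0).
have := le_trans (hardy v v_fin v0) (energy_le v v_fin).
rewrite !sum_at_e; first last.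
- by move=> n /cabs_v cv; rewrite /hardy_term cv expr0n mul0r.
- by move=> n /cabs_v ->; rewrite expr0n.
by rewrite /hardy_term norm_e /v eqxx [cabs _]Normc.normc1 expr1n divr1 !mulr1.
Qed.

Theorem corollary1p5 (R : realType) :
  exists (c1 c2 : R) (N : nat),
    [/\ 0 < c1, 0 < c2, (0 < N)%N &
      forall d : nat, (N <= d)%N ->
        c1 * d%:R <= hardy_const R d <= c2 * d%:R].
Proof.
exists 2^-1, 4, 32%N; split => // [|d d32]; first by rewrite invr_gt0.
have d_gt0 : (0 < d)%N by apply: leq_trans d32.
rewrite hardy_const_le// andbT mulrC.
by have [_] := hardy_const_max R d_gt0; apply; exact: hardy_ineq_half_dim.
Qed.
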